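(* Let $M \in \mathbb{Q}^{3\times3}$ have a non-real eigenvalue $\lambda$ (so its eigenvalues are $\lambda,\overline{\lambda}$ and a real $\rho$) such that $\gamma = \lambda/|\lambda|$ is not a root of unity, and let $s\in\mathbb{Q}^3$. Let $T_1,\dots,T_m \subseteq \mathbb{R}^3$ be semialgebraic sets, $N$ a nonnegative integer, and $J_1,\dots,J_m \subseteq \mathbb{T}$ finite unions of open arcs such that for all $1\le i\le m$ and all $n > N$: $n \in \mathcal{Z}(T_i)$ iff $\gamma^n \in J_i$. Then for every LTL formula $\varphi$ over $T_1,\dots,T_m$ there exists a finite union of open arcs $J_\varphi \subseteq \mathbb{T}$ such that for all $n > N$: $n\in\mathcal{Z}(\varphi)$ iff $\gamma^n \in J_\varphi$. Moreover, such $J_\varphi$ is unique.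
   Context: $\mathbb{T}$ is the unit circle in $\mathbb{C}$. LTL formulas over $T_1,\dots,T_m$ are generated by $\varphi ::= T_i \mid \varphi\wedge\varphi \mid \varphi\vee\varphi \mid \varphi\,\mathbf{U}\,\varphi \mid \varphi\,\mathbf{R}\,\varphi \mid \mathbf{X}\varphi$ (no negation), interpreted with standard LTL semantics on the orbit $\langle s, Ms, M^2s,\ldots\rangle$, where $T_i$ holds at position $n$ iff $M^n s\in T_i$. $\mathcal{Z}(\varphi) = \{n \ge 0 : \langle M^ns, M^{n+1}s,\ldots\rangle \models \varphi\}$.
   Formalization: Literal uniqueness of J_φ is false (the circle and the circle minus the point 1 both represent a formula that always holds); instead it is shown that there is a largest J_φ, and every other such set is contained in it and differs from it in finitely many points. *)

(* Defs.v *)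
From HB Require Import structures.
From mathcomp Require Export all_boot all_order all_algebra.
From mathcomp Require Export classical_sets cardinality reals trigo complex.
From mathcomp Require mpoly.

Set Implicit Arguments.
Unset Strict Implicit.
Unset Printing Implicit Defensive.
Import Order.TTheory GRing.Theory Num.Theory.

Local Open Scope classical_set_scope.
Local Open Scope ring_scope.

Section Semialgebraic.
Variables (R : realType) (d : nat).

Definition peval (p : mpoly.mpoly d R) (x : 'cV[R]_d) : R :=
  mpoly.meval (fun i => x i ord0) p.

Inductive semialgebraic : set 'cV[R]_d -> Prop :=
| semialg_eq (p : mpoly.mpoly d R) : semialgebraic [set x | peval p x = 0]
| semialg_gt (p : mpoly.mpoly d R) : semialgebraic [set x | 0 < peval p x]
| semialgC (A : set 'cV[R]_d) : semialgebraic A -> semialgebraic (~` A)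
| semialgI (A B : set 'cV[R]_d) :
    semialgebraic A -> semialgebraic B -> semialgebraic (A `&` B)
| semialgU (A B : set 'cV[R]_d) :
    semialgebraic A -> semialgebraic B -> semialgebraic (A `|` B).

End Semialgebraic.

Section Circle.
Variable R : realType.

Definition unit_circle : set R[i] := [set z | `|z| = 1].

(* The point e^(it) of the unit circle. *)
Definition cis (t : R) : R[i] := Complex (cos t) (sin t).

(* An arc of length 2 pi is the circle minus one point; the whole circle is a
   union of two arcs. *)
Definition open_arc (A : set R[i]) : Prop :=
  exists a b : R, [/\ a < b, b <= a + 2 * pi & A = cis @` [set t | a < t < b]].

(* The empty union is allowed. *)
Definition finite_union_open_arcs (J : set R[i]) : Prop :=
  exists (k : nat) (A : 'I_k -> set R[i]),
    (forall i, open_arc (A i)) /\ J = \bigcup_(i in [set: 'I_k]) A i.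

Lemma cis_unit_circle (t : R) : unit_circle (cis t).
Proof. by rewrite /unit_circle /= normc_def /= cos2Dsin2 sqrtr1. Qed.

Lemma finite_union_open_arcs_sub (J : set R[i]) :
  finite_union_open_arcs J -> J `<=` unit_circle.
Proof.
move=> [k [A [hA ->]]] z [i _ Aiz].
have [a [b [_ _ eA]]] := hA i.
by move: Aiz; rewrite eA => -[t _ <-]; exact: cis_unit_circle.
Qed.

Definition phase (z : R[i]) : R[i] := z / `|z|.

Definition root_of_unity (z : R[i]) : Prop :=
  exists k : nat, (0 < k)%N /\ z ^+ k = 1.

End Circle.

Inductive ltl (m : nat) : Type :=
| Atom of 'I_m
| And of ltl m & ltl m
| Or of ltl m & ltl m
| Until of ltl m & ltl m
| Release of ltl m & ltl m
| Next of ltl m.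

Definition suffix_word (S : Type) (k : nat) (w : nat -> S) : nat -> S :=
  fun j => w (k + j)%N.

Fixpoint models (S : Type) (m : nat) (T : 'I_m -> set S) (w : nat -> S)
    (f : ltl m) {struct f} : Prop :=
  match f with
  | Atom i => T i (w 0%N)
  | And f g => models T w f /\ models T w g
  | Or f g => models T w f \/ models T w g
  | Until f g =>
      exists k, models T (suffix_word k w) g /\
        forall j, (j < k)%N -> models T (suffix_word j w) f
  | Release f g =>
      forall k, models T (suffix_word k w) g \/
        exists j, (j < k)%N /\ models T (suffix_word j w) f
  | Next f => models T (suffix_word 1 w) f
  end.

Section Orbit.
Variables (R : realType) (d : nat).

Definition orbit_word (M : 'M[rat]_d) (s : 'cV[rat]_d) : nat -> 'cV[R]_d :=
  fun n => map_mx ratr (M ^+ n *m s).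

Definition Zset (M : 'M[rat]_d) (s : 'cV[rat]_d) (m : nat)
    (T : 'I_m -> set 'cV[R]_d) (f : ltl m) : set nat :=
  [set n | models T (suffix_word n (orbit_word M s)) f].

Definition complex_eigenvalue (M : 'M[rat]_d) (z : R[i]) : Prop :=
  eigenvalue (map_mx ratr M : 'M[R[i]]_d) z.

End Orbit.

(* J represents the set of times Z beyond the threshold N. *)
Definition represents (R : realType) (gamma : R[i]) (N : nat) (Z : set nat)
    (J : set R[i]) : Prop :=
  finite_union_open_arcs J /\
  forall n : nat, (N < n)%N -> (Z n <-> J (gamma ^+ n)).

Lemma cis_surj (R : realType) (z : R[i]) : unit_circle z ->
  z = 1 \/ exists2 t, 0 < t < 2 * pi & cis t = z.
Proof.
case: z => x y; rewrite /unit_circle /= normc_def /= => -[h].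
have h2 : x ^+ 2 + y ^+ 2 = 1.
  have h0 : 0 <= x ^+ 2 + y ^+ 2 by rewrite addr_ge0 ?sqr_ge0.
  by rewrite -(sqr_sqrtr h0) h expr1n.
have xb : -1 <= x <= 1.
  by rewrite -ler_norml -(@expr_le1 _ 2) // real_normK ?num_real // -h2 lerDl sqr_ge0.
have [x1|x1] := eqVneq x 1.
  left; move: h2; rewrite x1 expr1n => /eqP; rewrite -subr_eq0 addrAC subrr add0r.
  by rewrite sqrf_eq0 => /eqP ->.
right.
have hc : cos (acos x) = x by apply: acosK; rewrite in_itv.
have hs : sin (acos x) = `|y|.
  rewrite sin_acos //; have -> : 1 - x ^+ 2 = y ^+ 2 by rewrite -h2 addrAC subrr add0r.
  by rewrite sqrtr_sqr.
have a0 : 0 < acos x by apply: acos_gt0; rewrite lt_neqAle x1 //=; case/andP: xb => ->.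
have api : acos x <= pi by apply: acos_lepi.
have p0 : 0 < pi :> R := pi_gt0 R.
have [y0|y0] := leP 0 y.
  exists (acos x); last by rewrite /cis hc hs ger0_norm.
  by rewrite a0 (le_lt_trans api) // mulr_natl mulr2n ltrDl.
exists (2 * pi - acos x).
  by rewrite subr_gt0 ltrBlDr ltrDl a0 andbT (le_lt_trans api) // mulr_natl mulr2n ltrDl.
rewrite /cis mulr_natl addrC cosD sin2pi sinD sin2pi cos2pi !mulr0 !mulr1 subr0 addr0.
by rewrite cosN sinN hc hs ltr0_norm // opprK.
Qed.

(* Literal uniqueness of the representing set fails: the circle with and without
   the point 1 represent the same set of times, since gamma^n <> 1 for n > 0. *)
Lemma represents_not_unique (R : realType) (gamma : R[i]) (N : nat) :
  unit_circle gamma -> ~ root_of_unity gamma ->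
  exists J1 J2 : set R[i],
    [/\ represents gamma N setT J1, represents gamma N setT J2 & J1 <> J2].
Proof.
move=> g1 gU.
have p0 : 0 < pi :> R := pi_gt0 R.
pose A1 : set R[i] := @cis R @` [set t | 0 < t < 2 * pi].
pose A2 : set R[i] := @cis R @` [set t | - pi < t < pi].
have hA1 : open_arc A1.
  by exists 0, (2 * pi); split=> //; rewrite ?add0r // mulr_gt0.
have hA2 : open_arc A2.
  exists (- pi), pi; split=> //; first by rewrite gtrN.
  by rewrite mulr_natl mulr2n addrA addNr add0r.
have gA1 n : (N < n)%N -> A1 (gamma ^+ n).
  move=> Nn; have [|e|//] := @cis_surj R (gamma ^+ n).
    by rewrite /unit_circle /= normrX g1 expr1n.
  by case: gU; exists n; split=> //; exact: leq_ltn_trans Nn.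
have n1 : ~ A1 1.
  move=> [t /andP[t0 t2] [c1 s0]].
  have [tp|tp] := ltP t pi.
    by have := sin_gt0_pi (introT andP (conj t0 tp)); rewrite s0 ltxx.
  have := @cos_inj R (t - pi) pi.
  have hc : cos (t - pi) = -1 by rewrite cosB cospi sinpi s0 mulr0 addr0 c1 mul1r.
  rewrite hc cospi !in_itv /= subr_ge0 tp lerBlDr -mulr2n -mulr_natl ltW //.
  rewrite ltW //= lexx => /(_ isT isT erefl) /eqP.
  by rewrite subr_eq -mulr2n -mulr_natl => /eqP e; rewrite e ltxx in t2.
exists A1, (A1 `|` A2); split.
- split; last by move=> n Nn; split=> // _; exact: gA1.
  exists 1%N, (fun _ => A1); split=> //.
  by apply/seteqP; split=> [z h|z [i _ h]] //; exists ord0.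
- split; last by move=> n Nn; split=> // _; left; exact: gA1.
  exists 2%N, (fun i : 'I_2 => if val i == 0%N then A1 else A2); split.
    by move=> i; case: ifP.
  apply/seteqP; split=> [z [h|h]|z [i _]].
  + by exists ord0.
  + by exists (@Ordinal 2 1 isT).
  + by case: ifP => _ h; [left|right].
- move=> e; apply: n1; rewrite e; right; exists 0; last by rewrite /cis cos0 sin0.
  by rewrite /= oppr_lt0 p0.
Qed.

(* Main.v *)
(** Since gamma is not a root of unity, its powers visit every nonempty open arc with
    bounded gaps, uniformly in the starting point.  Hence a set of times represented by
    a finite union of open arcs J is either empty or has bounded gaps, and so is its
    complement, unless the complement of J is finite, in which case the set is cofinite.
    In every case the unbounded quantifiers in the semantics of U and R can be bounded,
    and finite unions of open arcs are closed under union, intersection and rotation.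
    Two representations agree on a dense set of points, so one exceeds the other only
    inside the finite boundary of the other; finitely many representations therefore
    already cover all of them, and their union is the largest one. *)
Require Import Defs.
From mathcomp Require Import boolp ring lra zify.

Set Implicit Arguments.
Unset Strict Implicit.
Unset Printing Implicit Defensive.
Import Order.TTheory GRing.Theory Num.Theory.

Local Open Scope classical_set_scope.
Local Open Scope ring_scope.

(** * The circle parametrised by angles modulo 2 pi *)

Section Cis.
Variable R : realType.
Implicit Types (t u c : R) (z : R[i]) (k : int) (n : nat).

Lemma twopi_gt0 : 0 < 2 * pi :> R.
Proof. by rewrite mulr_gt0 ?pi_gt0. Qed.

Lemma cisD t u : cis (t + u) = cis t * cis u.
Proof.
rewrite /cis cosD sinD; apply/eqP; rewrite eq_complex /= eqxx /=.
by apply/eqP; ring.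
Qed.

Lemma cis0 : cis 0 = 1 :> R[i].
Proof. by rewrite /cis cos0 sin0. Qed.

Lemma cisMn t n : cis (n%:R * t) = cis t ^+ n.
Proof.
elim: n => [|n IH]; first by rewrite mul0r cis0.
by rewrite exprS -IH -cisD -natr1 mulrDl mul1r addrC.
Qed.

Lemma cis_2pi : cis (2 * pi) = 1 :> R[i].
Proof. by rewrite /cis mulr_natl cos2pi sin2pi. Qed.

Lemma cisD_2piMz t k : cis (t + k%:~R * (2 * pi)) = cis t.
Proof.
have H n u : cis (u + n%:R * (2 * pi)) = cis u.
  by rewrite cisD cisMn cis_2pi expr1n mulr1.
case: k => n; first exact: H.
by rewrite NegzE -[in RHS](H n.+1) -[in RHS](subrK (n.+1%:R * (2 * pi)) t) !H
           mulrNz mulNr.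
Qed.

Lemma mod_2pi t c : exists k, c <= t + k%:~R * (2 * pi) < c + 2 * pi.
Proof.
have p0 := twopi_gt0.
have := floor_itv ((t - c) / (2 * pi)).
set k := Num.floor _ => /andP[h1 h2]; exists (- k).
move: h1 h2; rewrite ler_pdivlMr // ltr_pdivrMr // intrD mulrDl mulrNz mulNr.
by rewrite mulr1z mul1r => h1 h2; lra.
Qed.

Lemma cis_eq1 t : cis t = 1 -> exists k, t = k%:~R * (2 * pi).
Proof.
have p0 := twopi_gt0.
move=> e; have [k /andP[h1 h2]] := mod_2pi t 0.
exists (- k); apply/eqP; rewrite mulrNz mulNr -addr_eq0.
have : cis (t + k%:~R * (2 * pi)) = 1 by rewrite cisD_2piMz.
move: h1 h2; set r := t + _ => h1 h2 [+ _].
apply: contra_eqT => r0.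
(* By the half-angle formula cos r = 1 - 2 sin^2 (r / 2), which is below 1 when 0 < r < 2 pi. *)
have hs : 0 < sin (r / 2) by apply: sin_gt0_pi; lra.
have -> : r = (r / 2) *+ 2 by rewrite mulr2n; lra.
rewrite cos_mulr2n.
have := cos2Dsin2 (r / 2); have : 0 < sin (r / 2) ^+ 2 by rewrite exprn_gt0.
rewrite mulr2n => h h'; apply/eqP; lra.
Qed.

Lemma cis_eq t u : cis t = cis u -> exists k, t = u + k%:~R * (2 * pi).
Proof.
move=> e; have : cis (t - u) = 1 by rewrite cisD e -cisD subrr cis0.
by move=> /cis_eq1[k h]; exists k; rewrite -h addrC subrK.
Qed.

Lemma cis_inj t u : `|t - u| < 2 * pi -> cis t = cis u -> t = u.
Proof.
move=> h /cis_eq[k e]; move: h; rewrite e [u + _]addrC addrK normrM.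
rewrite (gtr0_norm twopi_gt0) -[ltRHS]mul1r ltr_pM2r ?twopi_gt0 //.
rewrite -intr_norm (ltr_int R _ 1) => h.
have -> : k = 0 by lia.
by rewrite mul0r add0r.
Qed.

Lemma unit_circle_cis z c : unit_circle z ->
  exists2 t, c <= t < c + 2 * pi & cis t = z.
Proof.
have H t : exists2 u, c <= u < c + 2 * pi & cis u = cis t.
  by have [k h] := mod_2pi t c; exists (t + k%:~R * (2 * pi)); rewrite ?cisD_2piMz.
by move=> /cis_surj[->|[t _ <-]]; rewrite -?cis0; exact: H.
Qed.

Lemma unit_circleM z w : unit_circle z -> unit_circle w -> unit_circle (z * w).
Proof. by rewrite /unit_circle /= normrM => -> ->; rewrite mulr1. Qed.

Lemma unit_circleX z n : unit_circle z -> unit_circle (z ^+ n).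
Proof. by rewrite /unit_circle /= normrX => ->; rewrite expr1n. Qed.

End Cis.

(** * Closure properties and boundary of finite unions of open arcs *)

Section FiniteUnions.
Variable R : realType.
Implicit Types (a b c t : R) (z g : R[i]) (A B J : set R[i]).

Lemma finite_union_open_arcs0 : finite_union_open_arcs (set0 : set R[i]).
Proof.
exists 0%N, (fun=> set0); split=> [[]//|].
by apply/seteqP; split=> // z [[]].
Qed.

Lemma finite_union_open_arcs_cons A J : open_arc A -> finite_union_open_arcs J ->
  finite_union_open_arcs (A `|` J).
Proof.
move=> hA [k [B [hB ->]]].
exists k.+1, (fun i => if unlift ord0 i is Some j then B j else A); split.
  by move=> i; case: unlift.
apply/seteqP; split=> [z [Az|[j _ Bz]]|z [i _]].
- by exists ord0 => //; rewrite unlift_none.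
- by exists (lift ord0 j) => //; rewrite liftK.
- by case: unlift => [j Bz|Az]; [right; exists j|left].
Qed.

(** Replaces indexed unions by an induction that adds one arc at a time. *)
Lemma finite_union_open_arcs_ind (P : set R[i] -> Prop) :
  P set0 -> (forall A J, open_arc A -> finite_union_open_arcs J -> P J -> P (A `|` J)) ->
  forall J, finite_union_open_arcs J -> P J.
Proof.
move=> P0 PU J [k [A [hA ->]]].
elim: k A hA => [|k IH] A hA.
  by have -> : \bigcup_(i in [set: 'I_0]) A i = set0 by apply/seteqP; split=> // z [[]].
have -> : \bigcup_(i in [set: 'I_k.+1]) A i
    = A ord0 `|` \bigcup_(i in [set: 'I_k]) A (lift ord0 i).
  apply/seteqP; split=> [z [i _ Az]|z [Az|[j _ Az]]].
  - by case: (unliftP ord0 i) Az => [j|] -> Az; [right; exists j|left].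
  - by exists ord0.
  - by exists (lift ord0 j).
apply: PU => //; last exact: IH.
by exists k, (fun j => A (lift ord0 j)).
Qed.

Lemma open_arc_finite_union A : open_arc A -> finite_union_open_arcs A.
Proof.
by move=> hA; rewrite -[A]setU0; apply: finite_union_open_arcs_cons => //;
  exact: finite_union_open_arcs0.
Qed.

Lemma finite_union_open_arcsU J1 J2 :
  finite_union_open_arcs J1 -> finite_union_open_arcs J2 ->
  finite_union_open_arcs (J1 `|` J2).
Proof.
move=> h1 h2; elim/finite_union_open_arcs_ind: J1 / h1 => [|A J hA _ IH].
  by rewrite set0U.
by rewrite -setUA; exact: finite_union_open_arcs_cons.
Qed.

(** The interval may be empty, so pieces of an intersection can be treated without checking that
    they are inhabited. *)
Lemma cis_itv_finite_union a b : b <= a + 2 * pi ->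
  finite_union_open_arcs (@cis R @` [set t | a < t < b]).
Proof.
move=> h; have [ab|ba] := ltP a b.
  by apply: open_arc_finite_union; exists a, b.
have -> : [set t | a < t < b] = set0.
  by apply/seteqP; split=> // t /= /andP[h1 h2]; lra.
by rewrite image_set0; exact: finite_union_open_arcs0.
Qed.

(** Translating the angles by full turns lets two arcs be compared on the real line, with a
    controlled offset between their left end points. *)
Lemma open_arc_near A c : open_arc A -> exists a b,
  [/\ a < b <= a + 2 * pi, a <= c < a + 2 * pi & A = @cis R @` [set t | a < t < b]].
Proof.
have p0 := twopi_gt0 R.
move=> [a [b [ab ba ->]]]; have [k /andP[h1 h2]] := mod_2pi c a; exists (a - k%:~R * (2 * pi)), (b - k%:~R * (2 * pi)).
split; [lra|lra|].
have E t : cis (t - k%:~R * (2 * pi)) = cis t.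
  by rewrite -[in RHS](subrK (k%:~R * (2 * pi)) t) cisD_2piMz.
apply/seteqP; split=> z [t /= ht <-].
  by exists (t - k%:~R * (2 * pi)); rewrite ?E //=; lra.
by exists (t + k%:~R * (2 * pi)); rewrite ?cisD_2piMz //=; lra.
Qed.

(** Two arcs can meet in two pieces. Once a <= c < a + 2 pi, the interval ]c, d[ can only meet ]a,
    b[ and its translate by one turn, which gives the values 0 and 1 of [k]. *)
Lemma open_arcI A B : open_arc A -> open_arc B -> finite_union_open_arcs (A `&` B).
Proof.
have p0 := twopi_gt0 R.
move=> + [c [d [cd dc ->]]] => /(open_arc_near c)[a [b [/andP[ab ba] /andP[ac ca] ->]]].
have -> : (@cis R @` [set t | a < t < b]) `&` (@cis R @` [set t | c < t < d]) =
  (@cis R @` [set t | c < t < Num.min b d]) `|`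
  (@cis R @` [set t | a + 2 * pi < t < Num.min (b + 2 * pi) d]).
  apply/seteqP; split=> [z [[t /= ht <-] [u hu /cis_eq[k e]]]|z [|] [t /= ht <-]].
  - have hk1 : -1 < k.
      rewrite -(ltr_int R) -(ltr_pM2r p0); move: hu; rewrite /= e; lra.
    have hk2 : k < 2.
      rewrite -(ltr_int R) -(ltr_pM2r p0); move: hu; rewrite /= e; lra.
    have {hk1 hk2} [k0|k1] : k = 0 \/ k = 1 by lia.
    + left; exists t => //=; move: hu; rewrite /= e k0 lt_min; lra.
    + right; exists u; last by rewrite e cisD_2piMz.
      move: hu; rewrite /= e k1 lt_min; lra.
  - by move: ht; rewrite lt_min => ht; split; exists t => //=; lra.
  - move: ht; rewrite lt_min => ht; split; last by exists t => //=; lra.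
    exists (t + (-1)%:~R * (2 * pi)); rewrite ?cisD_2piMz //=; lra.
apply: finite_union_open_arcsU; apply: cis_itv_finite_union; rewrite ge_min; lra.
Qed.

Lemma finite_union_open_arcsI J1 J2 :
  finite_union_open_arcs J1 -> finite_union_open_arcs J2 ->
  finite_union_open_arcs (J1 `&` J2).
Proof.
move=> h1 h2; elim/finite_union_open_arcs_ind: J1 / h1 => [|A J hA _ IH].
  by rewrite set0I; exact: finite_union_open_arcs0.
rewrite setIUl; apply: finite_union_open_arcsU => //.
elim/finite_union_open_arcs_ind: J2 / h2 {IH} => [|B J2 hB _ IH].
  by rewrite setI0; exact: finite_union_open_arcs0.
by rewrite setIUr; apply: finite_union_open_arcsU => //; exact: open_arcI.
Qed.

Lemma finite_union_open_arcs_rot g J : unit_circle g -> finite_union_open_arcs J ->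
  finite_union_open_arcs [set z | J (z * g)].
Proof.
move=> /(unit_circle_cis 0)[u _ <-] h.
elim/finite_union_open_arcs_ind: J / h => [|A J [a [b [ab ba ->]]] _ IH].
  exact: finite_union_open_arcs0.
have -> : [set z | ((@cis R @` [set t | a < t < b]) `|` J) (z * cis u)] =
   (@cis R @` [set t | a - u < t < b - u]) `|` [set z | J (z * cis u)].
  apply/seteqP; split=> [z [[t /= ht e]|]|z [[t /= ht <-]|]]; [left| |left|]; try by right.
    exists (t - u); first by rewrite /=; lra.
    by rewrite cisD e -mulrA -cisD subrr cis0 mulr1.
  by exists (t + u); rewrite ?cisD //=; lra.
by apply: finite_union_open_arcs_cons => //; exists (a - u), (b - u); split=> //; lra.
Qed.

(** [F] collects the end points of the arcs. A point outside [J] and outside [F] avoids every closed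
    arc, hence has an open arc around it in the exterior. *)
Lemma finite_union_open_arcs_boundary J : finite_union_open_arcs J ->
  exists F : seq R[i], forall z, unit_circle z ->
    [\/ J z, z \in F | exists A, [/\ open_arc A, A z & A `&` J = set0]].
Proof.
have p0 := twopi_gt0 R.
move: J; apply: finite_union_open_arcs_ind => [|A J hA hJ [F hF]].
  exists [::] => z hz; apply: Or33.
  have [t ht <-] := unit_circle_cis 0 hz.
  (* With no arc to avoid, any arc around z will do; this one is the circle minus the antipode of
     z. *)
  exists (@cis R @` [set u | t - pi < u < t + pi]); split; last by rewrite setI0.
    exists (t - pi), (t + pi); split=> //; lra.
  by exists t => //=; lra.
have [a [b [ab ba eA]]] := hA.
exists [:: cis a, cis b & F] => z hz.
have [Jz|zF|[B [hB Bz BJ]]] := hF z hz; [by apply: Or31; right| |].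
  by apply: Or32; rewrite !inE zF !orbT.
have [t ht ez] := unit_circle_cis a hz.
have [ta|ta] := eqVneq t a; first by apply: Or32; rewrite -ez ta !inE eqxx.
have [tb|tb] := eqVneq t b; first by apply: Or32; rewrite -ez tb !inE eqxx orbT.
have at' : a < t by rewrite lt_neqAle eq_sym ta; case/andP: ht.
case: (ltP t b) => [tlb|bt].
  by apply: Or31; left; rewrite eA; exists t => //=; rewrite at' tlb.
have {bt}bt : b < t by rewrite lt_neqAle eq_sym tb.
(* The exterior of [A]; it is nonempty because the angle t of z lies in it. *)
pose C := @cis R @` [set u | b < u < a + 2 * pi].
have hC : open_arc C by exists b, (a + 2 * pi); split=> //; lra.
have Cz : C z by exists t => //=; lra.
have CA : C `&` A = set0.
  apply/seteqP; split=> // w [[u /= hu <-]]; rewrite eA => -[v /= hv].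
  move=> /cis_inj e; have {}e : v = u by apply: e; rewrite ltr_norml; lra.
  lra.
(* The set B [&] C need not be a single arc, so the piece containing z is selected. *)
have [k [D [hD eD]]] := open_arcI hB hC.
have : (B `&` C) z by [].
rewrite eD => -[i _ Dz]; apply: Or33; exists (D i); split=> //.
apply/seteqP; split=> // w [Dw].
have : (B `&` C) w by rewrite eD; exists i.
move=> [Bw Cw] [Aw|Jw].
  by rewrite -CA.
by rewrite -BJ.
Qed.

End FiniteUnions.

(** * Recurrence of the powers of a point of infinite order *)

Section Recurrence.
Variable R : realType.
Implicit Types (a b t x d : R) (z : R[i]) (A J : set R[i]).

(** Pigeonhole: among the n + 1 fractional parts of k x, two fall into the same of n boxes of width
    1/n, and q is the difference of their indices. *)
Lemma dirichlet_approximation x (n : nat) : (0 < n)%N ->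
  exists (q : nat) (p : int), (0 < q)%N /\ `|q%:R * x - p%:~R| < n%:R^-1.
Proof.
move=> n0; have n0R : 0 < n%:R :> R by rewrite ltr0n.
pose fl (k : nat) := Num.floor (k%:R * x); pose fr k := k%:R * x - (fl k)%:~R.
have fr_itv k : 0 <= fr k < 1.
  have := floor_itv (k%:R * x); rewrite -/(fl k) intrD mulr1z /fr; lra.
have box_itv k : (Num.trunc (n%:R * fr k))%:R <= n%:R * fr k
    < (Num.trunc (n%:R * fr k)).+1%:R.
  by apply: truncn_itv; rewrite mulr_ge0 ?ler0n //; case/andP: (fr_itv k).
have box_lt k : (Num.trunc (n%:R * fr k) < n)%N.
  rewrite -(ltr_nat R); case/andP: (box_itv k) => h _; apply: le_lt_trans h _.
  by rewrite -[ltRHS]mulr1 ltr_pM2l //; case/andP: (fr_itv k).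
pose box (k : 'I_n.+1) := Ordinal (box_lt k).
have /injectivePn[i [j ij eb]] : ~~ injectiveb box.
  by apply/negP=> /injectiveP /leq_card; rewrite !card_ord ltnn.
have {}eb : Num.trunc (n%:R * fr i) = Num.trunc (n%:R * fr j) by case: eb.
have close (k l : nat) : Num.trunc (n%:R * fr k) = Num.trunc (n%:R * fr l) -> (k < l)%N ->
    exists (q : nat) (p : int), (0 < q)%N /\ `|q%:R * x - p%:~R| < n%:R^-1.
  move=> e kl; exists (l - k)%N, (fl l - fl k); split; first by rewrite subn_gt0.
  have -> : (l - k)%:R * x - (fl l - fl k)%:~R = fr l - fr k.
    by rewrite natrB ?(ltnW kl) // intrD mulrNz /fr; ring.
  rewrite -(ltr_pM2l n0R) divff ?gt_eqF // -[X in X * _](gtr0_norm n0R) -normrM.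
  have := box_itv k; have := box_itv l; rewrite e -natr1 ltr_norml.
  by move: (fr k) (fr l) => u v; rewrite mulrBr; lra.
by have [lt|lt|e] := ltngtP i j; [exact: close lt|exact: close lt|
  move: ij; rewrite (val_inj e) eqxx].
Qed.

(* Steps of length [d > 0] cannot jump over an interval longer than [d]. *)
Lemma walk_hits_itv a b d : 0 < d < b - a -> exists K : nat, forall t,
  exists2 k : nat, (k <= K)%N & exists l : int, a < t + k%:R * d + l%:~R * (2 * pi) < b.
Proof.
have p0 := twopi_gt0 R.
move=> /andP[d0 dab]; exists (Num.trunc (2 * pi / d)).+1 => t.
(* The walk starts at most one turn below a. Its step of index trunc y + 1 is the first one strictly
   beyond a, and it overshoots by at most d < b - a. *)
have [l /andP[h1 h2]] := mod_2pi t (a - 2 * pi).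
pose y := (a - (t + l%:~R * (2 * pi))) / d.
have y0 : 0 <= y by rewrite divr_ge0 ?(ltW d0) //; lra.
have yd : y * d = a - (t + l%:~R * (2 * pi)) by rewrite divfK ?gt_eqF.
have /andP[k1 k2] := truncn_itv y0.
exists (Num.trunc y).+1.
  by rewrite ltnS; apply: le_truncn; rewrite ler_pM2r ?invr_gt0 //; lra.
exists l; move: k1 k2; rewrite -(ler_pM2r d0) -(ltr_pM2r d0) yd -natr1 mulrDl; lra.
Qed.

Variable g : R[i].
Hypotheses (g1 : unit_circle g) (gU : ~ root_of_unity g).

(** Some power g^q is a rotation by a nonzero angle d shorter than the arc. Iterating it gives a
    walk that cannot jump over the arc. *)
Lemma open_arc_recurrent A : open_arc A -> exists K : nat, forall z,
  unit_circle z -> exists2 k, (k <= K)%N & A (z * g ^+ k).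
Proof.
have p0 := twopi_gt0 R.
move=> [a [b [ab ba ->]]].
have [th _ eg] := unit_circle_cis 0 g1.
have ba0 : 0 < (b - a) / (2 * pi) by rewrite divr_gt0 // subr_gt0.
(* Since n > 2 pi / (b - a), an error below 1/n of a turn is an angle below b - a. *)
pose n := (Num.trunc ((b - a) / (2 * pi))^-1).+1.
have [q [p [q0 hq]]] := @dirichlet_approximation (th / (2 * pi)) n isT.
pose d := q%:R * th - p%:~R * (2 * pi).
have gq : g ^+ q = cis d.
  by rewrite -eg -cisMn /d -mulNr -mulrNz cisD_2piMz.
have d0 : d != 0.
  by apply: contra_notN gU => /eqP e; exists q; rewrite gq e cis0.
have dab : `|d| < b - a.
  have -> : d = (q%:R * (th / (2 * pi)) - p%:~R) * (2 * pi).
    by rewrite mulrBl -[in RHS]mulrA divfK ?gt_eqF.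
  rewrite normrM (gtr0_norm p0) -ltr_pdivlMr //; apply: lt_trans hq _.
  rewrite -[ltRHS]invrK ltf_pV2 ?posrE ?invr_gt0 ?ltr0n //.
  by have /andP[] := truncn_itv (ltW (etrans (invr_gt0 _) ba0)).
have [K hK] : exists K : nat, forall t, exists2 k : nat, (k <= K)%N &
    exists l : int, a < t + k%:R * d + l%:~R * (2 * pi) < b.
  have [dn|dp|] := ltgtP d 0; last by move=> e; rewrite e eqxx in d0.
    (* A backward walk becomes a forward one under the reflection t -> -t. *)
    have [|K hK] := @walk_hits_itv (- b) (- a) (- d).
      by move: dab; rewrite ltr0_norm //; lra.
    exists K => t; have [k kK [l hl]] := hK (- t).
    by exists k => //; exists (- l); rewrite mulrNz; lra.
  by apply: walk_hits_itv; rewrite dp /=; move: dab; rewrite gtr0_norm.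
exists (q * K)%N => z /(unit_circle_cis 0)[t _ <-].
have [k kK [l hl]] := hK t.
exists (q * k)%N; first by rewrite leq_mul2l kK orbT.
exists (t + k%:R * d + l%:~R * (2 * pi)) => //.
by rewrite cisD_2piMz cisD exprM gq cisMn.
Qed.

Lemma finite_union_open_arcs_recurrent J : finite_union_open_arcs J ->
  J = set0 \/ exists K : nat, forall z,
    unit_circle z -> exists2 k, (k <= K)%N & J (z * g ^+ k).
Proof.
move: J; apply: finite_union_open_arcs_ind => [|A J hA _ _]; first by left.
right; have [K hK] := open_arc_recurrent hA; exists K => z hz.
by have [k kK Ak] := hK z hz; exists k => //; left.
Qed.

Lemma expr_inj_not_root_of_unity : injective (fun n : nat => g ^+ n).
Proof.
have g0 : g != 0.
  by apply/eqP=> e; have := g1; rewrite /unit_circle /= e normr0 => /esym/eqP;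
    rewrite oner_eq0.
have H m n : (m < n)%N -> g ^+ m = g ^+ n -> False.
  move=> mn e; apply: gU; exists (n - m)%N; rewrite subn_gt0; split=> //.
  by rewrite expfB // -e divff ?expf_neq0.
by move=> m n e; have [mn|nm|//] := ltngtP m n; [case: (H _ _ mn)|case: (H _ _ nm)].
Qed.

(** The powers are pairwise distinct, so each point of [F] is visited at most once. *)
Lemma expr_eventually_notin (F : seq R[i]) :
  exists K : nat, forall n, (K <= n)%N -> g ^+ n \notin F.
Proof.
elim: F => [|p F [K hK]]; first by exists 0%N.
have [[n0 e]|h] := pselect (exists n0, g ^+ n0 = p); last first.
  exists K => n Kn; rewrite inE negb_or hK // andbT.
  by apply/eqP => e; apply: h; exists n.
exists (maxn K n0.+1) => n; rewrite geq_max inE negb_or => /andP[Kn n0n].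
rewrite hK // andbT -e; apply/eqP => /expr_inj_not_root_of_unity en.
by rewrite en ltnn in n0n.
Qed.

End Recurrence.

(** * Sets of times represented by finite unions of open arcs *)

Section RepresentableSets.
Variables (R : realType) (g : R[i]) (N : nat).
Hypotheses (g1 : unit_circle g) (gU : ~ root_of_unity g).
Implicit Types (Z : set nat) (J : set R[i]).

Definition representable Z := exists J, represents g N Z J.

Lemma eq_representable Z1 Z2 : (forall n, (N < n)%N -> Z1 n <-> Z2 n) ->
  representable Z1 -> representable Z2.
Proof.
move=> e [J [hJ H]]; exists J; split=> // n Nn.
by rewrite -e //; exact: H.
Qed.

Lemma representable0 : representable set0.
Proof. by exists set0; split=> //; exact: finite_union_open_arcs0. Qed.

Lemma representableT : representable setT.
Proof. by have [J [_ [h _ _]]] := represents_not_unique N g1 gU; exists J. Qed.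

Lemma represents_setU Z J1 J2 :
  represents g N Z J1 -> represents g N Z J2 -> represents g N Z (J1 `|` J2).
Proof.
move=> [hJ1 H1] [hJ2 H2]; split; first exact: finite_union_open_arcsU.
move=> n Nn; split=> [/(H1 _ Nn)|[/(H1 _ Nn)|/(H2 _ Nn)]] //; by left.
Qed.

Lemma representableU Z1 Z2 :
  representable Z1 -> representable Z2 -> representable (Z1 `|` Z2).
Proof.
move=> [J1 [hJ1 H1]] [J2 [hJ2 H2]]; exists (J1 `|` J2).
split; first exact: finite_union_open_arcsU.
by move=> n Nn; rewrite /setU /= H1 // H2.
Qed.

Lemma representableI Z1 Z2 :
  representable Z1 -> representable Z2 -> representable (Z1 `&` Z2).
Proof.
move=> [J1 [hJ1 H1]] [J2 [hJ2 H2]]; exists (J1 `&` J2).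
split; first exact: finite_union_open_arcsI.
by move=> n Nn; rewrite /setI /= H1 // H2.
Qed.

(** As g^(n+k) = g^n g^k, a shift in time is a rotation of the representing set. *)
Lemma representable_shift Z k : representable Z -> representable [set n | Z (n + k)%N].
Proof.
move=> [J [hJ H]]; exists [set z | J (z * g ^+ k)].
split; first by apply: finite_union_open_arcs_rot => //; exact: unit_circleX.
by move=> n Nn; rewrite /= -exprD; apply: H; exact: ltn_addr.
Qed.

Lemma representable_exists (Z : nat -> set nat) K : (forall k, representable (Z k)) ->
  representable [set n | exists2 k, (k < K)%N & Z k n].
Proof.
move=> hZ; elim: K => [|K IH].
  by apply: eq_representable representable0 => n _; split=> // -[].
apply: eq_representable (representableU (hZ K) IH) => n _; split.
  by move=> [Zn|[k kK Zn]]; [exists K|exists k => //; exact: ltnW].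
move=> [k]; rewrite ltnS leq_eqVlt => /orP[/eqP ->|kK] Zn; first by left.
by right; exists k.
Qed.

Lemma representable_forall (Z : nat -> set nat) K : (forall k, representable (Z k)) ->
  representable [set n | forall k, (k < K)%N -> Z k n].
Proof.
move=> hZ; elim: K => [|K IH].
  by apply: eq_representable representableT => n _; split.
apply: eq_representable (representableI (hZ K) IH) => n _; split.
  move=> [ZK ZI] k; rewrite ltnS leq_eqVlt => /orP[/eqP ->|kK] //; exact: ZI.
by move=> h; split=> [|k kK]; apply: h => //; exact: ltnW.
Qed.

Lemma representable_recurrent Z : representable Z ->
  (forall n, (N < n)%N -> ~ Z n) \/
  exists K : nat, forall n, (N < n)%N -> exists2 k, (k <= K)%N & Z (n + k)%N.
Proof.
move=> [J [hJ H]].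
have [J0|[K hK]] := finite_union_open_arcs_recurrent g1 gU hJ.
  by left=> n Nn /(H _ Nn); rewrite J0.
right; exists K => n Nn; have [k kK Jk] := hK _ (unit_circleX n g1).
by exists k => //; apply/H; rewrite ?exprD //; exact: ltn_addr.
Qed.

(** The complement of [J] is not open, so recurrence is applied to an open arc in the exterior of
    [J]. If there is none, [J] covers the circle except for points of the finite [F], which the
    powers of [g] eventually avoid. *)
Lemma representableC_recurrent Z : representable Z ->
  (exists K : nat, forall n, (K <= n)%N -> Z n) \/
  exists K : nat, forall n, (N < n)%N -> exists2 k, (k <= K)%N & ~ Z (n + k)%N.
Proof.
move=> [J [hJ H]]; have [F hF] := finite_union_open_arcs_boundary hJ.
have [[A [hA AJ]]|noA] := pselect (exists A, open_arc A /\ A `&` J = set0).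
  right; have [K hK] := open_arc_recurrent g1 gU hA; exists K => n Nn.
  have [k kK Ak] := hK _ (unit_circleX n g1); exists k => // /H.
  rewrite exprD => /(_ (ltn_addr _ Nn)) Jk.
  by have : (A `&` J) (g ^+ n * g ^+ k) by []; rewrite AJ.
left; have [K hK] := expr_eventually_notin g1 gU F.
exists (maxn K N.+1) => n; rewrite geq_max => /andP[Kn Nn]; apply/H => //.
have [//|Fn|[A [hA _ AJ]]] := hF _ (unit_circleX n g1); last by case: noA; exists A.
by have := hK _ Kn; rewrite Fn.
Qed.

Lemma representable_until Z1 Z2 : representable Z1 -> representable Z2 ->
  representable [set n | exists k, Z2 (n + k)%N /\ forall j, (j < k)%N -> Z1 (n + j)%N].
Proof.
move=> h1 h2; have [h0|[K hK]] := representable_recurrent h2.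
  apply: eq_representable representable0 => n Nn; split=> // -[k [+ _]].
  by apply: h0; exact: ltn_addr.
apply: (@eq_representable [set n | exists2 k, (k < K.+1)%N &
    ([set n | Z2 (n + k)%N] `&` [set n | forall j, (j < k)%N -> Z1 (n + j)%N]) n]).
  move=> n Nn; split=> [[k _ h]|[k [Z2k Z1k]]]; first by exists k.
  have [kK|Kk] := leqP k K; first by exists k.
  (* A late witness k > K is replaced by k' <= K < k; the condition on [Z1] only gets weaker. *)
  have [k' k'K Z2k'] := hK n Nn; exists k' => //; split=> // j jk.
  by apply: Z1k; apply: ltn_trans jk _; exact: leq_ltn_trans Kk.
apply: representable_exists => k; apply: representableI; first exact: representable_shift.
by apply: representable_forall => j; exact: representable_shift.
Qed.

(** If the complement recurs, the condition never holds beyond [N]. Otherwise [Z] contains every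
    time from some K on, and n + k >= K as soon as k >= K, so only offsets below K need checking. *)
Lemma representable_always Z : representable Z ->
  representable [set n | forall k, Z (n + k)%N].
Proof.
move=> hZ; have [[K hK]|[K hK]] := representableC_recurrent hZ; last first.
  apply: eq_representable representable0 => n Nn; split=> // h.
  by have [k _] := hK n Nn; apply; exact: h.
apply: (@eq_representable [set n | forall k, (k < K)%N -> Z (n + k)%N]).
  move=> n _; split=> h k //; have [kK|Kk] := ltnP k K; first exact: h.
  by apply: hK; rewrite (leq_trans Kk) ?leq_addl.
by apply: representable_forall => k; exact: representable_shift.
Qed.

(** If [Z1] is empty beyond [N], release says that [Z2] always holds. Otherwise [Z1] occurs within K
    steps, which settles every offset k > K. *)
Lemma representable_release Z1 Z2 : representable Z1 -> representable Z2 ->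
  representable
    [set n | forall k, Z2 (n + k)%N \/ exists j, (j < k)%N /\ Z1 (n + j)%N].
Proof.
move=> h1 h2; have [h0|[K hK]] := representable_recurrent h1.
  apply: eq_representable (representable_always h2) => n Nn; split=> h k.
    by left.
  by have [//|[j [_ /h0]]] := h k; case; exact: ltn_addr.
apply: (@eq_representable [set n | forall k, (k < K.+1)%N ->
    ([set n | Z2 (n + k)%N] `|` [set n | exists2 j, (j < k)%N & Z1 (n + j)%N]) n]).
  move=> n Nn; split=> h k.
    have [kK|Kk] := ltnP k K.+1.
      by have [|[j jk Zj]] := h k kK; [left|right; exists j].
    have [j jK Zj] := hK n Nn; right; exists j; split=> //.
    exact: leq_ltn_trans Kk.
  by move=> _; have [|[j [jk Zj]]] := h k; [left|right; exists j].
apply: representable_forall => k; apply: representableU; first exact: representable_shift.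
by apply: representable_exists => j; exact: representable_shift.
Qed.

(* Two representations agree on the dense set of points [g ^+ n], [n > N], so the
   open set [J'] misses the exterior of [J]. *)
Lemma represents_setD Z J : represents g N Z J -> exists F : seq R[i],
  forall J', represents g N Z J' -> forall z, J' z -> ~ J z -> z \in F.
Proof.
move=> [hJ H]; have [F hF] := finite_union_open_arcs_boundary hJ.
exists F => J' [hJ' H'] z J'z nJz.
have [//|//|[A [hA Az AJ]]] := hF z (finite_union_open_arcs_sub hJ' J'z).
have hI := finite_union_open_arcsI (open_arc_finite_union hA) hJ'.
have [e|[K hK]] := finite_union_open_arcs_recurrent g1 gU hI.
  by have : (A `&` J') z by []; rewrite e.
(* Starting at g^(N+1) makes the time of the visit exceed [N], where both representations are
   valid. *)
have [k _] := hK _ (unit_circleX N.+1 g1).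
rewrite -exprD => -[Ak J'k]; have Nk : (N < N.+1 + k)%N by exact: ltn_addr.
have : (A `&` J) (g ^+ (N.+1 + k)) by split=> //; apply/(H _ Nk)/(H' _ Nk).
by rewrite AJ.
Qed.

Lemma representable_max Z : representable Z -> exists Jm, represents g N Z Jm /\
  forall J', represents g N Z J' -> J' `<=` Jm /\ finite_set (Jm `\` J').
Proof.
move=> [J0 hJ0]; have [F hF] := represents_setD hJ0.
(* Induction on [F]: if some representation contains the point p, adding that one representation
   absorbs p; otherwise nothing is to be done for p. *)
have [Jm [hJm [J0m Fm]]] : exists Jm, represents g N Z Jm /\ (J0 `<=` Jm /\
    forall J' z, represents g N Z J' -> z \in F -> J' z -> Jm z).
  elim: F {hF} => [|p F [Jm [hJm [J0m Fm]]]]; first by exists J0; do 2 split=> //.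
  have [[J1 [hJ1 J1p]]|h] := pselect (exists J1, represents g N Z J1 /\ J1 p).
    exists (Jm `|` J1); split; first exact: represents_setU.
    split=> [z /J0m|J' z hJ']; first by left.
    by rewrite inE => /orP[/eqP ->|zF J'z]; [right|left; exact: Fm J'z].
  exists Jm; split=> //; split=> // J' z hJ'.
  by rewrite inE => /orP[/eqP -> J'p|]; [case: h; exists J'|exact: Fm].
exists Jm; split=> // J' hJ'; split.
  move=> z J'z; have [/J0m //|nJz] := pselect (J0 z).
  by apply: (Fm J') => //; exact: (hF J').
(* The same comparison with the roles exchanged: [Jm] exceeds J' only inside a finite set. *)
have [F' hF'] := represents_setD hJ'.
by apply: (@sub_finite_set _ _ [set` F']) => [z [Jz nJ'z]|//]; exact: (hF' Jm).
Qed.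

End RepresentableSets.

(** * From closure properties to LTL formulas *)

Lemma suffix_wordD (S : Type) (w : nat -> S) (n k : nat) :
  suffix_word k (suffix_word n w) = suffix_word (n + k) w.
Proof. by apply: funext => j; rewrite /suffix_word addnA. Qed.

(** Structural induction: each connective is one of the closure properties above, once nested
    suffixes are rewritten as sums of times. *)
Lemma models_representable (R : realType) (g : R[i]) (N : nat) (S : Type) (m : nat)
    (T : 'I_m -> set S) (w : nat -> S) :
  unit_circle g -> ~ root_of_unity g ->
  (forall i, representable g N [set n | models T (suffix_word n w) (Atom i)]) ->
  forall f, representable g N [set n | models T (suffix_word n w) f].
Proof.
move=> g1 gU hT; elim=> [i|f IHf h IHh|f IHf h IHh|f IHf h IHh|f IHf h IHh|f IHf] //.
- exact: representableI.
- exact: representableU.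
- apply: eq_representable (representable_until g1 gU IHf IHh) => n _ /=.
  split=> -[k [hk fk]]; exists k; split=> [|j jk]; rewrite ?suffix_wordD //.
  + exact: fk.
  + by rewrite -suffix_wordD.
  + by rewrite -suffix_wordD; exact: fk.
- apply: eq_representable (representable_release g1 gU IHf IHh) => n _ /=.
  by split=> H k; have [hk|[j [jk fj]]] := H k; [left|right; exists j|left|right; exists j];
    rewrite ?suffix_wordD // -suffix_wordD.
- apply: eq_representable (representable_shift g1 1 IHf) => n _ /=.
  by rewrite suffix_wordD.
Qed.

Lemma phase_unit_circle (R : realType) (z : R[i]) : z != 0 -> unit_circle (phase z).
Proof.
by move=> z0; rewrite /unit_circle /phase /= normrM normfV normr_id divff ?normr_eq0.
Qed.

(** Uniqueness is expressed up to finitely many points, since [represents_not_unique] refutes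
    literal equality: [Jphi] is the largest representing set, and every other one misses only
    finitely many of its points. *)
Theorem theorem7 (R : realType) (M : 'M[rat]_3) (s : 'cV[rat]_3)
    (lambda : R[i])
    (lambda_eigen : complex_eigenvalue M lambda)
    (lambda_nonreal : lambda \isn't Num.real)
    (gamma_not_root : ~ root_of_unity (phase lambda))
    (m : nat) (T : 'I_m -> set 'cV[R]_3)
    (T_semialg : forall i, semialgebraic (T i))
    (N : nat) (J : 'I_m -> set R[i])
    (J_repr : forall i,
      represents (phase lambda) N (Zset M s T (Atom i)) (J i))
    (phi : ltl m) :
  exists Jphi : set R[i],
    represents (phase lambda) N (Zset M s T phi) Jphi /\
    (forall J' : set R[i],
      represents (phase lambda) N (Zset M s T phi) J' ->
      J' `<=` Jphi /\ finite_set (Jphi `\` J')).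
Proof.
have g1 : unit_circle (phase lambda).
  (* The phase of 0 would be 0 by the convention for division; a non-real eigenvalue is nonzero
     because 0 is real. *)
  by apply: phase_unit_circle; apply: contraNneq lambda_nonreal => ->; exact: real0.
apply: representable_max => //.
by apply: models_representable g1 gamma_not_root _ phi => i; exists (J i); exact: J_repr.
Qed.
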